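(* Let $\mathcal V,\mathcal W,a_\varepsilon,f_\varepsilon,J_\varepsilon,u_\varepsilon,q_\varepsilon$ be as in the context, and let $n\ge1$. Assume: (1) There exist numbers $\delta a^{(i)},\delta f^{(i)},\delta J^{(i)}$, $i=1,\dots,n$, and a function $\ell_1:\mathbb R^+\to\mathbb R^+$ with $\lim_{\varepsilon\searrow0}\ell_1(\varepsilon)=0$ such that $$(a_\varepsilon-a_0)(u_0,q_0)=\ell_1(\varepsilon)\sum_{i=0}^{n-1}\varepsilon^i\delta a^{(i+1)}+o(\varepsilon^n\ell_1(\varepsilon)),$$ $$(f_\varepsilon-f_0)(q_0)=\ell_1(\varepsilon)\sum_{i=0}^{n-1}\varepsilon^i\delta f^{(i+1)}+o(\varepsilon^n\ell_1(\varepsilon)),\qquad (J_\varepsilon-J_0)(u_0)=\ell_1(\varepsilon)\sum_{i=0}^{n-1}\varepsilon^i\delta J^{(i+1)}+o(\varepsilon^n\ell_1(\varepsilon)).$$ (2) There exist numbers $\delta A^{(i)},\delta F^{(i)}$, $i=1,\dots,n$, such that $$(a_\varepsilon-a_0)(u_0,q_\varepsilon-q_0)=\ell_1(\varepsilon)\sum_{i=0}^{n-1}\varepsilon^i\delta A^{(i+1)}+o(\varepsilon^n\ell_1(\varepsilon)),\qquad (f_\varepsilon-f_0)(q_\varepsilon-q_0)=\ell_1(\varepsilon)\sum_{i=0}^{n-1}\varepsilon^i\delta F^{(i+1)}+o(\varepsilon^n\ell_1(\varepsilon)).$$ Then $$J_\varepsilon(u_\varepsilon)=J_0(u_0)+\ell_1(\varepsilon)\sum_{i=0}^{n-1}\varepsilon^i\big(\delta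 J^{(i+1)}+\delta a^{(i+1)}-\delta f^{(i+1)}+\delta A^{(i+1)}-\delta F^{(i+1)}\big)+o(\varepsilon^n\ell_1(\varepsilon)).$$
   Context: $\mathcal V,\mathcal W$ are real Hilbert spaces. For all small $\varepsilon\ge0$, $a_\varepsilon$ is a bilinear form on $\mathcal V\times\mathcal W$, $f_\varepsilon$ a linear form on $\mathcal W$, and $u_\varepsilon\in\mathcal V$ is the unique solution of $a_\varepsilon(u_\varepsilon,\varphi)=f_\varepsilon(\varphi)$ for all $\varphi\in\mathcal W$; it is assumed that $u_\varepsilon-u_0\in\mathcal W$ for all $\varepsilon$. $J_\varepsilon:\mathcal V\to\mathbb R$ is a functional differentiable at $u_0$ such that for all $\varphi\in\mathcal V$ and $\varepsilon\ge0$ the function $s\mapsto\partial J_\varepsilon(su_\varepsilon+(1-s)u_0)(\varphi)$ is (well defined and) continuously differentiable on $[0,1]$. The averaged adjoint $q_\varepsilon\in\mathcal W$ is the (assumed unique and existing) solution of $a_\varepsilon(\varphi,q_\varepsilon)=-\int_0^1\partial J_\varepsilon(su_\varepsilon+(1-s)u_0)(\varphi)\,ds$ for all $\varphi\in\mathcal V$; $q_0$ is the solution for $\varepsilon=0$. *)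

(* Defs.v *)
From HB Require Import structures.
From mathcomp Require Import all_boot all_order all_algebra.
From mathcomp Require Import all_classical all_reals all_analysis.

Set Implicit Arguments.
Unset Strict Implicit.
Unset Printing Implicit Defensive.

Import Order.TTheory GRing.Theory Num.Theory.
Import numFieldNormedType.Exports.

Local Open Scope classical_set_scope.
Local Open Scope ring_scope.

HB.mixin Record isHilbert (R : realType) V of CompleteNormedModule R V := {
  hilbert_inner : {dot V for (@idfun R)};
  hilbert_normE : forall x : V, `|x| ^+ 2 = hilbert_inner x x }.

#[short(type="hilbertType")]
HB.structure Definition Hilbert (R : realType) :=
  {V of isHilbert R V & CompleteNormedModule R V}.

(* The difference quotients are restricted to [a, b], so the derivative is
   one-sided at the end points and the values of g outside [a, b] play no
   role. *)
Definition continuously_differentiable_on (R : realType) (a b : R)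
    (g : R -> R) : Prop :=
  exists dg : R -> R,
    (forall s, s \in `[a, b] ->
       (t - s)^-1 * (g t - g s) @[t --> within [set` `[a, b]] s^'] --> dg s) /\
    {within [set` `[a, b]], continuous dg}.

Section equations.
Variables (R : realType) (V W : hilbertType R).

Definition state_eq (a : V -> W -> R) (f : W -> R) (u : V) : Prop :=
  forall phi : W, a u phi = f phi.

(* 'D_phi J is the directional derivative, which is the Frechet derivative
   applied to phi wherever J is Frechet differentiable. *)
Definition segment_derivative (J : V -> R) (u0 u1 phi : V) (s : R) : R :=
  'D_phi J (s *: u1 + (1 - s) *: u0).

Definition averaged_adjoint_eq (a : V -> W -> R) (J : V -> R) (u0 u1 : V)
    (q : W) : Prop :=
  forall phi : V, a phi q =
    - \int[lebesgue_measure]_(s in [set` `[0, 1]])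
        segment_derivative J u0 u1 phi s.

End equations.

(* Main.v *)
(** Applying the averaged adjoint equation to [u e - u 0] turns the increment of
    [J e] between [u 0] and [u e], written as an integral along the segment,
    into the residual [a e (u 0) (q e) - f e (q e)] of the state equation.
    Since [a 0 (u 0) (q e) = f 0 (q e)], this residual involves only the
    differences [a e - a 0] and [f e - f 0], which gives an exact formula for
    [J e (u e) - J 0 (u 0)] as a combination of the five expanded quantities. *)
Require Import Defs.
From mathcomp Require Import all_boot all_order all_algebra.
From mathcomp Require Import all_classical all_reals all_analysis.
From mathcomp Require Import ring lra.

Set Implicit Arguments.
Unset Strict Implicit.
Unset Printing Implicit Defensive.

Import Order.TTheory GRing.Theory Num.Theory.
Import numFieldNormedType.Exports.

Local Open Scope classical_set_scope.
Local Open Scope ring_scope.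

(** Near [s] the increment of [g] is [t - s] times a difference quotient with a finite limit, so it
    tends to 0. This is applied to the segment derivative, to make it integrable by the fundamental
    theorem of calculus. *)
Lemma continuously_differentiable_on_continuous (R : realType) (a b : R)
    (g : R -> R) :
  continuously_differentiable_on a b g ->
  {within [set` `[a, b]], continuous g}.
Proof.
case=> dg [dgE _]; apply/subspace_continuousP => s sab.
have quotient := dgE s sab.
have increment : (t - s) * ((t - s)^-1 * (g t - g s))
    @[t --> within [set` `[a, b]] s^'] --> 0 * dg s.
  apply: cvgM quotient; rewrite -(subrr s).
  apply: cvg_within_filter; apply: cvg_within_filter.
  by apply: cvgB; [exact: cvg_id | exact: cvg_cst].
rewrite mul0r in increment.
apply/cvgrPdist_lt => e e0.
move/cvgrPdist_lt : increment => /(_ e e0).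
rewrite !near_withinE => near_s.
(* The quotient is controlled only on a punctured neighbourhood, so [t = s] is treated apart. *)
near=> t => tab; have [->|ts] := eqVneq t s; first by rewrite subrr normr0.
have : t != s -> [set` `[a, b]] t ->
    `|0 - (t - s) * ((t - s)^-1 * (g t - g s))| < e by near: t.
by rewrite mulrA divff ?subr_eq0// mul1r sub0r opprB; apply.
Unshelve. all: by end_near. Qed.

Section segment_derivative.
Variables (R : realType) (V W : hilbertType R) (J : V -> R) (u0 u1 : V).

(** Increasing the parameter by [h] moves the point of the segment by [h *: (u1 - u0)]. The
    difference quotients of the path are thus exactly the directional ones, and directional
    derivability replaces a chain rule. *)
Lemma is_derive_segment (s : R) :
  derivable J (s *: u1 + (1 - s) *: u0) (u1 - u0) ->
  is_derive s 1 (fun t => J (t *: u1 + (1 - t) *: u0))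
    (segment_derivative J u0 u1 (u1 - u0) s).
Proof.
set p := s *: u1 + _; move=> dJ.
have quotientE : (fun h : R => h^-1 *:
      (J ((h *: 1 + s) *: u1 + (1 - (h *: 1 + s)) *: u0) - J p)) =
    (fun h => h^-1 *: (J (h *: (u1 - u0) + p) - J p)).
  apply/funext => h; congr (_ *: (J _ - _)); rewrite /p scalerBr !scalerBl.
  rewrite [h *: 1]mulr1 !scalerDl opprD.
  by rewrite [RHS]addrACA; congr (_ + _); rewrite addrCA.
split; first by rewrite /derivable /= quotientE.
by rewrite /segment_derivative /derive /= quotientE.
Qed.

Lemma Rintegral_segment_derivative :
  (forall s : R, 0 <= s <= 1 ->
     derivable J (s *: u1 + (1 - s) *: u0) (u1 - u0)) ->
  {within [set` `[0, 1]],
     continuous (segment_derivative J u0 u1 (u1 - u0))} ->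
  \int[lebesgue_measure]_(s in [set` `[0, 1]])
     segment_derivative J u0 u1 (u1 - u0) s = J u1 - J u0.
Proof.
move=> dJ cdJ; pose g (s : R) := J (s *: u1 + (1 - s) *: u0).
have dg (s : R) : 0 <= s <= 1 ->
    is_derive s 1 g (segment_derivative J u0 u1 (u1 - u0) s).
  by move=> /dJ /is_derive_segment.
have cg (s : R) : 0 <= s <= 1 -> {for s, continuous g}.
  by move=> /dg [? _]; exact/differentiable_continuous/derivable1_diffP.
rewrite /Rintegral (@continuous_FTC2 R _ g 0 1 ltr01 cdJ).
- by rewrite -EFinB /= /g !scale1r subrr subr0 !scale0r scale1r addr0 add0r.
(* At 0 and 1 the path [g] is still derivable from both sides, which yields the one-sided continuity
   there. *)
- split=> [s /[!in_itv]/= /andP[/ltW s0 /ltW s1]||].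
  + by have [|? _] := dg s; first rewrite s0.
  + by apply: cvg_at_right_filter; apply: cg; rewrite lexx ler01.
  + by apply: cvg_at_left_filter; apply: cg; rewrite lexx ler01.
- move=> s /[!in_itv]/= /andP[/ltW s0 /ltW s1].
  by rewrite derive1E; have [|_ <-] := dg s; first rewrite s0.
Qed.

(** The test function is [u1 - u0]: its integral in the adjoint equation is the increment of [J],
    and the minus sign there reverses the difference on the right. *)
Lemma averaged_adjoint_increment (a : {bilinear V -> W -> R | *%R & *%R})
    (q : W) :
  averaged_adjoint_eq a J u0 u1 q ->
  (forall s : R, 0 <= s <= 1 ->
     derivable J (s *: u1 + (1 - s) *: u0) (u1 - u0)) ->
  {within [set` `[0, 1]],
     continuous (segment_derivative J u0 u1 (u1 - u0))} ->
  J u1 - J u0 = a u0 q - a u1 q.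
Proof.
move=> adj dJ cdJ; rewrite -(Rintegral_segment_derivative dJ cdJ).
by rewrite -[LHS]opprK -adj linearBl opprB.
Qed.

End segment_derivative.

Section eqaddo_arith.
Variables (K : numFieldType) (T : Type) (U U' : normedModType K).
Variables (F : filter_on T) (h : T -> U').
Implicit Types f g : T -> U.

(** Together with the next two lemmas, this lets expansions with a common remainder scale be
    combined as if they were equations. *)
Lemma eqaddoD f g f' g' :
  f = g +o_F h -> f' = g' +o_F h -> f + f' = (g + g') +o_F h.
Proof. by move=> -> ->; rewrite addrACA addo; exact: eqaddoE. Qed.

Lemma eqaddoN f g : f = g +o_F h -> - f = (- g) +o_F h.
Proof. by move=> ->; rewrite opprD oppo; exact: eqaddoE. Qed.

Lemma eqaddoB f g f' g' :
  f = g +o_F h -> f' = g' +o_F h -> f - f' = (g - g') +o_F h.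
Proof. by move=> fg /eqaddoN; exact: eqaddoD. Qed.

End eqaddo_arith.

(* The space E only gives a meaning to u e - u 0 \in W: V and W are embedded
   in it by iV and iW (E = V and iV = id when W is a subspace of V). *)
Theorem proposition2p5 (R : realType) (V W : hilbertType R)
  (E : lmodType R) (iV : {linear V -> E}) (iW : {linear W -> E})
  (iV_inj : injective iV) (iW_inj : injective iW)
  (eps0 : R) (eps0_gt0 : 0 < eps0)
  (a : R -> {bilinear V -> W -> R | *%R & *%R})
  (f : R -> {scalar W})
  (J : R -> V -> R) (u : R -> V) (q : R -> W)
  (state : forall e : R, 0 <= e < eps0 -> unique (state_eq (a e) (f e)) (u e))
  (diff_in_W : forall e : R, 0 <= e < eps0 -> exists w : W, iW w = iV (u e - u 0))
  (J_diff : forall e : R, 0 <= e < eps0 -> differentiable (J e) (u 0))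
  (J_segment_derivable : forall e : R, 0 <= e < eps0 ->
     forall (phi : V) (s : R), 0 <= s <= 1 ->
     derivable (J e) (s *: u e + (1 - s) *: u 0) phi)
  (J_segment_C1 : forall e : R, 0 <= e < eps0 -> forall phi : V,
     continuously_differentiable_on 0 1
       (segment_derivative (J e) (u 0) (u e) phi))
  (averaged_adjoint : forall e : R, 0 <= e < eps0 ->
     unique (averaged_adjoint_eq (a e) (J e) (u 0) (u e)) (q e))
  (n : nat) (n_ge1 : (1 <= n)%N)
  (da df dJ dA dF : nat -> R)
  (ell1 : R -> R) (ell1_ge0 : forall e : R, 0 < e -> 0 <= ell1 e)
  (ell1_cvg0 : ell1 e @[e --> 0^'+] --> 0)
  (expansion_a :
     (fun e => a e (u 0) (q 0) - a 0 (u 0) (q 0)) =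
     (fun e => ell1 e * \sum_(0 <= i < n) e ^+ i * da i.+1)
       +o_ (0^'+) (fun e => e ^+ n * ell1 e))
  (expansion_f :
     (fun e => f e (q 0) - f 0 (q 0)) =
     (fun e => ell1 e * \sum_(0 <= i < n) e ^+ i * df i.+1)
       +o_ (0^'+) (fun e => e ^+ n * ell1 e))
  (expansion_J :
     (fun e => J e (u 0) - J 0 (u 0)) =
     (fun e => ell1 e * \sum_(0 <= i < n) e ^+ i * dJ i.+1)
       +o_ (0^'+) (fun e => e ^+ n * ell1 e))
  (expansion_A :
     (fun e => a e (u 0) (q e - q 0) - a 0 (u 0) (q e - q 0)) =
     (fun e => ell1 e * \sum_(0 <= i < n) e ^+ i * dA i.+1)
       +o_ (0^'+) (fun e => e ^+ n * ell1 e))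
  (expansion_F :
     (fun e => f e (q e - q 0) - f 0 (q e - q 0)) =
     (fun e => ell1 e * \sum_(0 <= i < n) e ^+ i * dF i.+1)
       +o_ (0^'+) (fun e => e ^+ n * ell1 e)) :
  (fun e => J e (u e)) =
  (fun e => J 0 (u 0) + ell1 e * \sum_(0 <= i < n) e ^+ i *
     (dJ i.+1 + da i.+1 - df i.+1 + dA i.+1 - dF i.+1))
    +o_ (0^'+) (fun e => e ^+ n * ell1 e).
Proof.
have incrementE e : 0 < e < eps0 -> J e (u e) - J 0 (u 0) =
    (J e (u 0) - J 0 (u 0)) + (a e (u 0) (q 0) - a 0 (u 0) (q 0))
    - (f e (q 0) - f 0 (q 0))
    + (a e (u 0) (q e - q 0) - a 0 (u 0) (q e - q 0))
    - (f e (q e - q 0) - f 0 (q e - q 0)).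
  case/andP=> e0 ee0.
  have he : 0 <= e < eps0 by apply/andP; split => //; exact: ltW.
  have h0 : (0 : R) <= 0 < eps0 by apply/andP.
  have := averaged_adjoint_increment (averaged_adjoint e he).1
    (J_segment_derivable e he _)
    (continuously_differentiable_on_continuous (J_segment_C1 e he _)).
  (* The state equation at [e] turns [a e (u e) (q e)] into [f e (q e)]; the one at 0 allows
     subtracting [a 0 (u 0) (q e) - f 0 (q e) = 0]. Splitting [q e] as [q 0 + (q e - q 0)] then
     leaves linear arithmetic. *)
  have := (state e he).1 (q e).
  have := (state 0 h0).1 (q e).
  have := (state 0 h0).1 (q 0).
  rewrite !linearBr !(linearB (f _)) /=.
  lra.
have sumE e : \sum_(0 <= i < n) e ^+ i *
      (dJ i.+1 + da i.+1 - df i.+1 + dA i.+1 - dF i.+1) =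
    \sum_(0 <= i < n) e ^+ i * dJ i.+1 + \sum_(0 <= i < n) e ^+ i * da i.+1
    - \sum_(0 <= i < n) e ^+ i * df i.+1 + \sum_(0 <= i < n) e ^+ i * dA i.+1
    - \sum_(0 <= i < n) e ^+ i * dF i.+1.
  rewrite -!(big_split, sumrB) /=; apply: eq_bigr => i _; ring.
have /eqaddoP expansion := eqaddoB (eqaddoD (eqaddoB
  (eqaddoD expansion_J expansion_a) expansion_f) expansion_A) expansion_F.
(* The increment formula holds only for [0 < e < eps0], so it is used inside the eventual norm bound
   rather than as an equality of functions. *)
apply/eqaddoP => c /expansion; apply: filter_app.
near=> e; have he : 0 < e < eps0.
  by apply/andP; split; near: e; [exact: nbhs_right_gt|exact: nbhs_right_lt].
have incrementE_e := incrementE e he.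
(* Both remainders coincide at such [e], so the bound carries over with the same constant [c]. *)
apply: le_trans; rewrite le_eqVlt; apply/orP; left; apply/eqP; congr (`|_|).
rewrite !fctE sumE; lra.
Unshelve. all: by end_near. Qed.
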